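(* For integers $n \ge 2$ and $k \in \{1,\ldots,n-1\}$ (where $k$ may depend on $n$), let $\pi$ be a permutation chosen uniformly at random from the symmetric group $\mathcal{S}_n$ and let $L_{n,k} = L_{n,k}(\pi)$ be the length of the longest $k$-alternating subsequence of $\pi$. Then, as $n \to \infty$, $$\mathbb{E}\, L_{n,k} = \frac{2(n-k)}{3} + O(n^{2/3}).$$
   Context: A permutation $\pi \in \mathcal{S}_n$ is viewed as the word $(\pi(1),\ldots,\pi(n))$. A subsequence of $\pi$ is $(\pi(i_1),\ldots,\pi(i_m))$ with $1 \le i_1 < \cdots < i_m \le n$. For a positive integer $k$, a finite sequence of numbers $(a_1,\ldots,a_m)$ is called $k$-alternating if $(-1)^j (a_j - a_{j+1}) \ge k$ for all $j \in \{1,\ldots,m-1\}$; that is, $a_2 \ge a_1 + k$, $a_2 \ge a_3 + k$, $a_4 \ge a_3 + k$, and so on (so it alternates up, down, up, \dots, with every jump of size at least $k$). Sequences of length $0$ or $1$ are trivially $k$-alternating. *)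

(* Defs.v *)
From mathcomp Require Import all_boot all_order all_fingroup all_algebra.

Set Implicit Arguments.
Unset Strict Implicit.
Unset Printing Implicit Defensive.

Import GRing.Theory Num.Theory.

Local Open Scope ring_scope.

(* The sequence is a_1, ..., a_m with a_j = a`_(j-1), so that the sign attached
   to the 0-based position j is (-1)^(j+1): the first step goes up. *)
Definition k_alternating (k : nat) (a : seq int) : bool :=
  [forall j : 'I_(size a).-1, k%:Z <= (-1) ^+ j.+1 * (a`_j - a`_j.+1)].

(* [enum I] lists I in increasing order; the shift by one identifies the values
   'I_n = {0, ..., n-1} with {1, ..., n}. *)
Definition subword (n : nat) (s : 'S_n) (I : {set 'I_n}) : seq int :=
  [seq (s i).+1%:Z | i <- enum I].

Definition longest_alt (n k : nat) (s : 'S_n) : nat :=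
  \max_(I : {set 'I_n} | k_alternating k (subword s I)) size (subword s I).

Definition expect_unif (R : numFieldType) (T : finType) (X : T -> R) : R :=
  (\sum_(t : T) X t) / #|T|%:R.

Definition mean_longest_alt (R : numFieldType) (n k : nat) : R :=
  expect_unif (fun s : 'S_n => (longest_alt k s)%:R).

(* Main.v *)
(* Call a position i a peak of s if, on each side of i, some value at most
   s(i) - k occurs before any value larger than s(i).  Maxima of a k-alternating
   subsequence can be replaced by peaks, and consecutive peaks are separated by a
   value lying k below both, so that 2P <= L <= 2P + 2, where P is the number of
   peaks.
   A value x is a peak iff its two neighbours, in the word restricted to
   M = {y | y <= x - k or y >= x}, both lie in the l-element set {y | y <= x - k}.
   If l > 0 then M has m = n - k + 1 elements; by symmetry all ordered pairs of
   distinct neighbours are equally likely, and x is first (last) in M with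
   probability 1/m, so x is a peak with probability l(l-1) / (m(m-1)).  Summing
   over l gives E P = (n - k - 1)/3 exactly, and the error is in fact O(1). *)

Require Import Defs.
From mathcomp Require Import all_boot all_order all_fingroup all_algebra.
From mathcomp Require Import all_classical all_reals all_analysis.
From mathcomp Require Import zify ring lra.

Set Implicit Arguments.
Unset Strict Implicit.
Unset Printing Implicit Defensive.

Import Order.TTheory GRing.Theory Num.Theory.

(** * Neighbours and end elements in a listing of a finite set *)

(* [a] and [b] are consecutive when [M] is listed by increasing [f]. *)
Definition adj (T : finType) (n : nat) (M : {set T}) (f : T -> 'I_n) (a b : T) :=
  (f a < f b) && [forall y in M, ~~ (f a < f y < f b)].

(** Lets facts about left neighbours be reused for right neighbours. *)
Lemma adj_rev (T : finType) n (M : {set T}) (f : T -> 'I_n) a b :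
  adj M (@rev_ord n \o f) b a = adj M f a b.
Proof.
have H u v : (rev_ord (f u) < rev_ord (f v)) = (f v < f u).
  by rewrite /=; have := ltn_ord (f u); have := ltn_ord (f v); lia.
rewrite /adj /= H; congr (_ && _).
by apply: eq_forallb => y; rewrite !H [X in ~~ X]andbC.
Qed.

Lemma adj_inj (T : finType) n (M : {set T}) (f : T -> 'I_n) a b x :
  injective f -> a \in M -> b \in M -> adj M f a x -> adj M f b x -> a = b.
Proof.
move=> fI aM bM /andP[ax /forall_inP/(_ b bM) Ha] /andP[bx /forall_inP/(_ a aM) Hb].
apply: fI; apply: val_inj => /=; move: Ha Hb; rewrite ax bx !andbT -!leqNgt => *.
by lia.
Qed.

Lemma sum_adj (T : finType) n (M L : {set T}) (f : T -> 'I_n) x :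
  injective f -> L \subset M ->
  \sum_(a in L) adj M f a x = [exists a in L, adj M f a x].
Proof.
move=> fI /fintype.subsetP LM; case: existsP => [[a /andP[aL ax]]|H].
  rewrite (bigD1 a) //= ax big1 // => b /andP[bL /eqP neq].
  case bx : (adj M f b x) => //; case: neq.
  by apply: (adj_inj fI) bx ax; apply: LM.
rewrite big1 // => a aL; case ax : (adj M f a x) => //.
by case: H; exists a; rewrite aL.
Qed.

(** With [f] composed with [rev_ord], this expresses being last. *)
Definition first (T : finType) n (M : {set T}) (f : T -> 'I_n) x :=
  [forall y in M, f x <= f y].

(** The left neighbour is the element of [M] with the largest [f] below [f x]. *)
Lemma exists_adj (T : finType) n (M : {set T}) (f : T -> 'I_n) x :
  [exists a in M, adj M f a x] = ~~ first M f x.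
Proof.
rewrite /first negb_forall; apply/existsP/existsP => -[a].
  by case/andP=> aM /andP[ax _]; exists a; rewrite aM -ltnNge.
rewrite negb_imply -ltnNge => Pa.
case: (@arg_maxnP T a (fun y => (y \in M) && (f y < f x)) (fun y => f y : nat) Pa)
  => b /andP[bM bx] bmax.
exists b; rewrite bM /adj bx; apply/forall_inP => y yM; apply/negP => /andP[bny ynx].
by have := bmax y; rewrite yM ynx => /(_ isT); rewrite /= leqNgt bny.
Qed.

Lemma sum_first (T : finType) n (M : {set T}) (f : T -> 'I_n) :
  injective f -> 0 < #|M| -> \sum_(x in M) first M f x = 1.
Proof.
move=> fI /card_gt0P[x xM].
case: (@arg_minnP T x (mem M) (fun y => f y : nat) xM) => b bM bmin.
rewrite (bigD1 b) //= big1 ?addn0; last first.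
  move=> c /andP[cM cb]; case H : (first M f c) => //; move/forall_inP: H => /(_ b bM) H.
  by case/eqP: cb; apply: fI; apply: val_inj; apply/eqP; rewrite eqn_leq H bmin.
by rewrite (_ : first M f b) //; apply/forall_inP => y /bmin.
Qed.

(** * Neighbour counts over all permutations, by symmetry *)

Lemma adj_permM n (M : {set 'I_n}) (p t : 'S_n) a b : t @: M = M ->
  adj M (t * p)%g a b = adj M p (t a) (t b).
Proof.
move=> tM; rewrite /adj !permM; congr (_ && _).
apply/forall_inP/forall_inP => H y yM.
  by move: yM; rewrite -tM => /imsetP[z zM ->]; have := H z zM; rewrite permM.
by rewrite permM; apply: H; rewrite -tM imset_f.
Qed.

Lemma first_permM n (M : {set 'I_n}) (p t : 'S_n) x : t @: M = M ->
  first M (t * p)%g x = first M p (t x).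
Proof.
move=> tM; rewrite /first.
apply/forall_inP/forall_inP => H y yM.
  by move: yM; rewrite -tM => /imsetP[z zM ->]; have := H z zM; rewrite !permM.
by rewrite !permM; apply: H; rewrite -tM imset_f.
Qed.

Lemma tperm_imset n (M : {set 'I_n}) a b : a \in M -> b \in M -> tperm a b @: M = M.
Proof.
move=> aM bM; apply/eqP; rewrite eqEcard card_imset; last exact: perm_inj.
rewrite leqnn andbT; apply/fintype.subsetP => _ /imsetP[z zM ->].
by case: tpermP => // ->.
Qed.

(** Transpositions within [M] make the count the same for all its elements, and each permutation has
    exactly one first element in [M]. *)
Lemma sum_perm_first n (M : {set 'I_n}) x : x \in M ->
  #|M| * (\sum_(p : 'S_n) first M p x) = n`!.
Proof.
move=> xM.
have E y : y \in M -> \sum_(p : 'S_n) first M p y = \sum_(p : 'S_n) first M p x.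
  move=> yM; rewrite (reindex_inj (mulgI (tperm x y))) /=.
  by apply: eq_bigr => p _; rewrite first_permM ?tperm_imset // tpermR.
rewrite -sum_nat_const -(eq_bigr _ E) exchange_big /= (eq_bigr (fun _ => 1)); last first.
  by move=> p _; apply: sum_first; [exact: perm_inj | apply/card_gt0P; exists x].
by rewrite sum1_card card_Sn.
Qed.

Definition rev_perm n : 'S_n := perm (@rev_ord_inj n).

Lemma sum_perm_last n (M : {set 'I_n}) x :
  \sum_(p : 'S_n) first M (@rev_ord n \o p) x = \sum_(p : 'S_n) first M p x.
Proof.
rewrite [RHS](reindex_inj (mulIg (rev_perm n))) /=.
apply: eq_bigr => p _; congr (nat_of_bool _).
by apply: eq_forallb => y; rewrite !permM !permE.
Qed.

Definition flanked n (M L : {set 'I_n}) (p : 'S_n) x :=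
  [exists a in L, adj M p a x] && [exists b in L, adj M p x b].

(** [x] has at most one neighbour on each side, so the double sum is 0 or 1. *)
Lemma flanked_sum n (M L : {set 'I_n}) (p : 'S_n) x : L \subset M ->
  flanked M L p x = \sum_(a in L) \sum_(b in L) adj M p a x * adj M p x b :> nat.
Proof.
move=> LM; under eq_bigr do rewrite -big_distrr /=.
rewrite -big_distrl /= sum_adj //; last exact: perm_inj.
rewrite (eq_bigr (fun b => nat_of_bool (adj M (@rev_ord n \o p) b x))); last first.
  by move=> b _; rewrite adj_rev.
rewrite sum_adj //; last by apply: inj_comp; [exact: rev_ord_inj | exact: perm_inj].
rewrite mulnb; congr (nat_of_bool (_ && _)).
by apply: eq_existsb => b; rewrite adj_rev.
Qed.

(** The three events are exclusive: a second element of [M] keeps [x] from being both first and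
    last. *)
Lemma flanked_first_last n (M : {set 'I_n}) (p : 'S_n) x : x \in M -> 1 < #|M| ->
  flanked M (M :\ x) p x + first M p x + first M (@rev_ord n \o p) x = 1.
Proof.
move=> xM M1.
have E : flanked M (M :\ x) p x = ~~ first M p x && ~~ first M (@rev_ord n \o p) x.
  rewrite -!exists_adj; congr (_ && _); apply: eq_existsb => a; rewrite ?adj_rev !inE.
    by case: eqVneq => [->|_] /=; rewrite ?/adj ?ltnn ?andbF.
  by case: eqVneq => [->|_] /=; rewrite ?/adj ?ltnn ?andbF.
have F : ~~ (first M p x && first M (@rev_ord n \o p) x).
  apply/negP => /andP[/forall_inP H1 /forall_inP H2].
  have : 0 < #|M :\ x| by rewrite (cardsD1 x M) xM in M1.
  case/card_gt0P => y; rewrite !inE => /andP[/eqP yx yM]; case: yx.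
  apply: (@perm_inj _ p); apply: val_inj => /=.
  apply/eqP; rewrite eqn_leq (H1 y yM) andbT; move: (H2 y yM) => /=.
  by have := ltn_ord (p x); have := ltn_ord (p y); move: (p x : nat) (p y : nat) => u v; lia.
by move: F; rewrite E; case: first; case: first.
Qed.

Definition count_nbrs n (M : {set 'I_n}) x a b :=
  \sum_(p : 'S_n) adj M p a x * adj M p x b.

Lemma count_nbrs_const n (M : {set 'I_n}) x : x \in M -> exists c,
  {in M :\ x &, forall a b, a != b -> count_nbrs M x a b = c}.
Proof.
move=> xM.
(* Relabel by some [t] that fixes [x], preserves [M] and sends (a, b) to (a', b'). *)
have E a b a' b' : a \in M :\ x -> b \in M :\ x -> a' \in M :\ x -> b' \in M :\ x ->
    a != b -> a' != b' -> count_nbrs M x a b = count_nbrs M x a' b'.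
  rewrite !inE => /andP[ax aM] /andP[bx bM] /andP[ax' aM'] /andP[bx' bM'] ab ab'.
  (* [tperm a a'] moves [b] to [b1]; as [b1] and [b'] differ from [a'], the second transposition
     leaves [a'] alone. *)
  pose b1 := tperm a a' b; pose t := (tperm a a' * tperm b1 b')%g.
  have b1a : b1 != a'.
    by apply: contra ab => /eqP H; rewrite -(inj_eq (@perm_inj _ (tperm a a'))) -/b1 H tpermL.
  have b1M : b1 \in M by rewrite /b1; case: tpermP.
  have b1x : b1 != x by rewrite /b1; case: tpermP.
  have tM : t @: M = M.
    have -> : t @: M = tperm b1 b' @: (tperm a a' @: M).
      by rewrite -imset_comp; apply: eq_imset => y; rewrite permM.
    by rewrite !tperm_imset.
  have ta : t a = a' by rewrite permM tpermL tpermD // eq_sym.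
  have tb : t b = b' by rewrite permM tpermL.
  have tx : t x = x by rewrite permM !tpermD // eq_sym.
  rewrite /count_nbrs (reindex_inj (mulgI t)) /=.
  by apply: eq_bigr => p _; rewrite !adj_permM // ta tb tx.
have [/existsP[u /and3P[u1 u2 uu]]|H] :=
  boolP [exists u : 'I_n * 'I_n, [&& u.1 \in M :\ x, u.2 \in M :\ x & u.1 != u.2]].
  by exists (count_nbrs M x u.1 u.2) => a b aM bM ab; apply: E.
(* [M :\ x] has no two distinct elements, so any constant works. *)
exists 0 => a b aM bM ab; case/negP: H; apply/existsP; exists (a, b).
by rewrite /= aM bM.
Qed.

Lemma sum_count_nbrs n (M L : {set 'I_n}) x c :
  {in L &, forall a b, a != b -> count_nbrs M x a b = c} ->
  \sum_(a in L) \sum_(b in L) count_nbrs M x a b = #|L| * (#|L| - 1) * c.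
Proof.
move=> H; rewrite -mulnA -sum_nat_const; apply: eq_bigr => a aL.
(* The diagonal term vanishes: no [a] lies on both sides of [x]. *)
rewrite (big_setD1 a) //= [X in X + _]big1 => [|p _]; last first.
  rewrite mulnb; apply/eqP; rewrite eqb0 /adj; apply/negP.
  by move=> /andP[/andP[H1 _] /andP[H2 _]]; lia.
rewrite add0n (eq_bigr (fun _ => c)) => [|b]; last first.
  by rewrite !inE => /andP[ba bL]; apply: H => //; rewrite eq_sym.
by rewrite sum_nat_const (cardsD1 a L) aL add1n subn1.
Qed.

(** The common count [c] is found from the case [L = M :\ x], where flanked means neither first nor
    last, two events already counted. *)
Lemma sum_perm_flanked n (M L : {set 'I_n}) x : x \in M -> L \subset M :\ x -> 1 < #|M| ->
  #|M| * (#|M| - 1) * (\sum_p flanked M L p x) = #|L| * (#|L| - 1) * n`!.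
Proof.
move=> xM LM M1; have [c Hc] := count_nbrs_const xM.
have S (L' : {set 'I_n}) : L' \subset M :\ x ->
    \sum_p flanked M L' p x = #|L'| * (#|L'| - 1) * c.
  move=> LM'; rewrite -(@sum_count_nbrs n M L' x c); last first.
    by apply: sub_in2 Hc; exact: fintype.subsetP LM'.
  under eq_bigr do rewrite flanked_sum ?(fintype.subset_trans LM') ?finset.subD1set //.
  by rewrite exchange_big /=; apply: eq_bigr => a _; rewrite exchange_big.
have T : \sum_p flanked M (M :\ x) p x + \sum_(p : 'S_n) first M p x
    + \sum_(p : 'S_n) first M p x = n`!.
  rewrite -{2}sum_perm_last -card_Sn -sum1_card -!big_split /=.
  by apply: eq_bigr => p _; rewrite -(flanked_first_last p xM M1).
have F := sum_perm_first xM.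
have mx : #|M| = #|M :\ x|.+1 by rewrite (cardsD1 x M) xM.
have l := subset_leq_card LM.
rewrite S // in T; rewrite S //.
move: T F l; rewrite mx; move: M1; rewrite mx.
move: (\sum_(p : 'S_n) _) #|M :\ x| #|L| (n`!) => F [|[|m]] l N // _ T H lm.
  (* With only one other element in [M], [c] is undetermined, but [#|L| <= 1] makes both sides
     vanish. *)
  by case: l lm => [|[]] //; rewrite !muln0.
have {}H : m.+1 * (m.+2 * c * m.+3) = m.+1 * N.
  have : m.+3 * (m.+2 * (m.+2 - 1) * c) + 2 * N = m.+3 * N.
    rewrite -[in RHS]T -H; ring.
  by rewrite !subSS !subn0; lia.
by move/eqP: H; rewrite eqn_pmul2l // => /eqP <-; rewrite !subSS !subn0; ring.
Qed.

(** * Alternating subsequences compared with peaks *)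

(** Removing two terms keeps the parity of positions, hence the signs, so up-down pairs can be
    peeled off by induction. *)
Lemma k_alternating_cons2 k a b c t :
  k_alternating k [:: a, b, c & t] =
  [&& (a + k%:Z <= b)%R, (c + k%:Z <= b)%R & k_alternating k (c :: t)].
Proof.
rewrite /k_alternating /=.
have signr3 j : ((-1) ^+ j.+3 = (-1) ^+ j.+1 :> int)%R
  by rewrite !exprS !mulN1r opprK.
apply/forallP/and3P.
  move=> H; split.
  - have /= := H (@Ordinal (size t).+2 0 isT); lia.
  - have /= := H (@Ordinal (size t).+2 1 isT); lia.
  - apply/forallP => -[j jt].
    by have /= := H (@Ordinal (size t).+2 j.+2 jt); rewrite signr3.
case=> ab cb /forallP H [[|[|j]] jt] /=.
- by lia.
- by lia.
have := H (@Ordinal (size t) j jt) => /=.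
by rewrite signr3.
Qed.

Lemma k_alternating1 k a : k_alternating k [:: a].
Proof. by apply/forallP => -[]. Qed.

Definition peak (n : nat) (k : nat) (s : 'S_n) (i : 'I_n) :=
  [exists l : 'I_n, exists r : 'I_n,
    [&& l < i < r, s l + k <= s i, s r + k <= s i &
      [forall j : 'I_n, (l < j < r) ==> (s j <= s i)]]].

Lemma peakP n k (s : 'S_n) (i : 'I_n) :
  reflect (exists l r : 'I_n, [/\ l < i < r, s l + k <= s i, s r + k <= s i
     & forall j : 'I_n, l < j < r -> s j <= s i]) (peak k s i).
Proof.
apply: (iffP existsP) => [[l /existsP[r /and4P[lir sl sr /forallP H]]]|[l [r [lir sl sr H]]]].
  by exists l, r; split => // j jlr; have := H j; rewrite jlr.
exists l; apply/existsP; exists r; apply/and4P; split => //.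
by apply/forallP => j; apply/implyP/H.
Qed.

Definition vals n (s : 'S_n) (t : seq 'I_n) : seq int := [seq (s i).+1%:Z%R | i <- t].

(* Between two consecutive minima of an alternating subsequence, the maximum of
   [s] is a peak. *)
Lemma alt_le_peaks n k (s : 'S_n) (t : seq 'I_n) (i0 : 'I_n) : 0 < k ->
  (* A maximum left over at the end of the subsequence is rounded away by [./2]. *)
  path (fun i j : 'I_n => i < j) i0 t -> k_alternating k (vals s (i0 :: t)) ->
  (size t)./2 <= #|[set i | peak k s i & i0 < i]|.
Proof.
move=> k0; have [m] := ubnP (size t); elim: m t i0 => // m IH [|b [|c t]] i0 //= tm.
case/and3P=> ib bc pt; rewrite k_alternating_cons2 => /and3P[ab cb kt].
have Pb : (i0 < b < c) by rewrite ib bc.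
case: (@arg_maxnP _ (b : 'I_n) (fun j : 'I_n => i0 < j < c) (fun j => s j : nat) Pb)
  => i ic imax.
have [i0i ltic] := andP ic.
have sb := imax _ Pb.
have pi : peak k s i.
  apply/peakP; exists i0, c; split=> //; try exact: imax; lia.
have := IH t c _ pt kt; rewrite /= => /(_ ltac:(lia)) H.
apply: (@leq_trans (#|i |: [set j | peak k s j & c < j]|)).
  by rewrite cardsU1 inE negb_and -leqNgt (ltnW ltic) orbT /= add1n ltnS.
apply/subset_leq_card/fintype.subsetP => j; rewrite !inE => /orP[/eqP->|/andP[-> cj]].
  by rewrite pi i0i.
by rewrite /=; lia.
Qed.

(* Between two consecutive peaks, the low value flanking the smaller peak on the
   side of the other one is a valley for both. *)
Lemma peaks_le_alt n k (s : 'S_n) (t : seq 'I_n) (p v : 'I_n) : 0 < k ->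
  path (fun i j : 'I_n => i < j) p t -> all (peak k s) (p :: t) ->
  v < p -> s v + k <= s p ->
  exists u : seq 'I_n, [/\ path (fun i j : 'I_n => i < j) v u,
    k_alternating k (vals s (v :: u)) & size u = (size t).+1.*2].
Proof.
move=> k0; elim: t p v => [|p' t IH] p v.
  move=> _ /andP[/peakP[l [r [/andP[lp pr] sl sr _]]] _] vp sv.
  exists [:: p; r] => /=; rewrite vp pr; split => //.
  by rewrite /vals /= k_alternating_cons2 k_alternating1 andbT; lia.
case/andP=> pp' pt /andP[Pp Pt] vp sv.
have [w /and4P[pw wp' wp wp1]] : exists w : 'I_n,
    [&& p < w, w < p', s w + k <= s p & s w + k <= s p'].
  have [/peakP[l [r [/andP[lp pr] sl sr H]]]] := (Pp : peak k s p).
  have [/peakP[l' [r' [/andP[lp' pr'] sl' sr' H']]]] := andP Pt.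
  have [E|E] := leqP (s p) (s p').
    exists r; apply/and4P; split => //; try lia.
    (* Were [r] beyond [p'], the window of [p] would contain [p'], forcing [s p' = s p]. *)
    rewrite ltnNge; apply/negP => p'r.
    have rp' : r != p' by apply/eqP => X; subst; lia.
    have := H p'; rewrite (ltn_trans lp pp') /= ltn_neqAle p'r andbT.
    have -> : (p' != r :> nat) by rewrite eq_sym.
    move=> /(_ isT) E'.
    have : s p = s p' by apply: val_inj; apply/eqP; rewrite eqn_leq E E'.
    by move/perm_inj => X; subst; rewrite ltnn in pp'.
  move=> _; exists l'; apply/and4P; split => //; try lia.
  rewrite ltnNge; apply/negP => lp1.
  have rp' : l' != p by apply/eqP => X; subst; lia.
  have := H' p; rewrite (ltn_trans pp' pr') andbT ltn_neqAle lp1 andbT.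
  have -> : (l' != p :> nat) by [].
  by move=> /(_ isT); lia.
have [u [pu ku su]] := IH p' w pt Pt wp' wp1.
exists [:: p, w & u]; rewrite /= vp pw pu su; split => //.
rewrite /vals /= k_alternating_cons2; apply/and3P; split => //; lia.
Qed.

Lemma sorted_enum n (I : {set 'I_n}) : sorted (fun i j : 'I_n => i < j) (enum I).
Proof.
rewrite {1}/enum_mem -enumT; apply: sorted_filter; first by move=> a b c; apply: ltn_trans.
by have := iota_ltn_sorted 0 n; rewrite -val_enum_ord sorted_map.
Qed.

Lemma enum_sorted n (t : seq 'I_n) : sorted (fun i j : 'I_n => i < j) t ->
  enum [set i in t] = t.
Proof.
have tr : transitive (fun i j : 'I_n => i < j) by move=> a b c; apply: ltn_trans.
have ir : irreflexive (fun i j : 'I_n => i < j) by move=> a; apply: ltnn.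
move=> st; apply: (irr_sorted_eq tr ir (sorted_enum _) st) => i.
by rewrite mem_enum inE.
Qed.

(** A subsequence of [m] terms yields at least [(m - 1)./2] peaks; conversely [P > 0] peaks yield
    [2P + 1] terms, starting from a low value before the first peak. *)
Lemma longest_alt_peaks n k (s : 'S_n) : 0 < k ->
  (#|[set i | peak k s i]|).*2 <= longest_alt k s <= (#|[set i | peak k s i]|).*2.+2.
Proof.
move=> k0; apply/andP; split; last first.
  apply/bigmax_leqP => I; rewrite /subword size_map.
  have := sorted_enum I; case: (enum I) => [|i0 t] //= pt kt.
  have H := alt_le_peaks k0 pt kt.
  have H' : #|[set i | peak k s i & i0 < i]| <= #|[set i | peak k s i]|.
    by apply/subset_leq_card/fintype.subsetP => j; rewrite !inE => /andP[].
  by have := leq_trans H H'; move: (size t) #|_| => a b; lia.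
case E : (enum [set i | peak k s i]) => [|p t].
  by rewrite cardE E.
have := sorted_enum [set i | peak k s i]; rewrite E /= => pt.
have al : all (peak k s) (p :: t).
  by rewrite -E; apply/allP => i; rewrite mem_enum inE.
have /andP[/peakP[l [r [/andP[lp pr] sl sr _]]] _] := al.
have [u [pu ku su]] := peaks_le_alt k0 pt al lp sl.
have eu := enum_sorted (t := l :: u) pu.
rewrite cardE E; apply: (@leq_trans (size (subword s [set i in l :: u]))).
  by rewrite /subword eu size_map /= su; lia.
rewrite /longest_alt; apply: (@leq_bigmax_cond _ (fun I => k_alternating k (subword s I))
  (fun I => size (subword s I))).
by rewrite /subword eu.
Qed.

(** * Peaks as flanked values, and their total number *)

(** The form [y + k <= x] avoids truncated [x - k], which would make 0 low when [x < k]. *)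
Definition low n k (x : 'I_n) : {set 'I_n} := [set y : 'I_n | y + k <= x].
Definition relevant n k (x : 'I_n) : {set 'I_n} := low k x :|: [set y : 'I_n | x <= y].

(* [s^-1] sends a value to its position. *)
Lemma peak_flanked n k (s : 'S_n) i : 0 < k ->
  peak k s i = flanked (relevant k (s i)) (low k (s i)) s^-1%g (s i).
Proof.
move=> k0; apply/peakP/andP => [[l [r [/andP[li ir] sl sr H]]]|].
  split; apply/existsP.
    (* Take the low value nearest to [i] on the left: a relevant value in between would be low,
       against maximality, or at least [s i], against the window from [l] to [r]. *)
    case: (@arg_maxnP _ l (fun j : 'I_n => (j < i) && (s j + k <= s i)) (fun j => j : nat)).
      by rewrite li.
    move=> a /andP[ai sa] amax; exists (s a); rewrite !inE sa /adj !permK ai /=.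
    apply/forall_inP => y; rewrite !inE => yM; apply/negP => /andP[ay yi].
    have E : s ((s^-1)%g y) = y by rewrite permKV.
    have la : l <= a by apply: amax; rewrite li.
    case/orP: yM => yx.
      by have := amax ((s^-1)%g y); rewrite yi E yx /= => /(_ isT); lia.
    have := H ((s^-1)%g y); rewrite (leq_ltn_trans la ay) (ltn_trans yi ir) E => /(_ isT) yx'.
    have X : y = s i by apply: val_inj; apply/eqP; rewrite eqn_leq yx yx'.
    by rewrite X permK ltnn in yi.
  case: (@arg_minnP _ r (fun j : 'I_n => (i < j) && (s j + k <= s i)) (fun j => j : nat)).
    by rewrite ir.
  move=> a /andP[ai sa] amin; exists (s a); rewrite !inE sa /adj !permK ai /=.
  apply/forall_inP => y; rewrite !inE => yM; apply/negP => /andP[yi ya].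
  have E : s ((s^-1)%g y) = y by rewrite permKV.
  have ar : a <= r by apply: amin; rewrite ir.
  case/orP: yM => yx.
    by have := amin ((s^-1)%g y); rewrite yi E yx /= => /(_ isT); lia.
  have := H ((s^-1)%g y); rewrite (leq_trans ya ar) (ltn_trans li yi) E => /(_ isT) yx'.
  have X : y = s i by apply: val_inj; apply/eqP; rewrite eqn_leq yx yx'.
  by rewrite X permK ltnn in yi.
case=> /exists_inP[a]; rewrite inE /adj permK => sa /andP[ai /forall_inP Ha].
case/exists_inP=> b; rewrite inE => sb /andP[ib /forall_inP Hb].
exists ((s^-1)%g a), ((s^-1)%g b); rewrite !permKV ai ib; split => // j /andP[aj jb].
rewrite leqNgt; apply/negP => ij.
have jM : s j \in relevant k (s i) by rewrite !inE (ltnW ij) orbT.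
have := Ha _ jM; have := Hb _ jM; rewrite !permK aj jb andbT -!leqNgt => ji ij'.
have X : j = i by apply: val_inj; apply/eqP; rewrite eqn_leq ji ij'.
by rewrite X ltnn in ij.
Qed.

Lemma card_ord_ltn n m : m <= n -> #|[set y : 'I_n | y < m]| = m.
Proof.
move=> mn; rewrite cardsE -sum1_card.
by rewrite -(big_ord_widen n (fun=> 1) mn) sum1_card card_ord.
Qed.

Lemma card_low n k (x : 'I_n) : #|low k x| = x.+1 - k.
Proof.
rewrite -(@card_ord_ltn n (x.+1 - k)); last by have := ltn_ord x; lia.
by apply: eq_card => y; rewrite !inE; apply/idP/idP; lia.
Qed.

(** The complement consists of the [k - 1] values strictly between [x - k] and [x]. *)
Lemma card_relevant n k (x : 'I_n) : 0 < k <= x -> #|relevant k x| = (n - k).+1.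
Proof.
case/andP=> k0 kx.
have -> : relevant k x = ~: ([set y : 'I_n | y < x] :\: low k x).
  by apply/setP => y; rewrite !inE; lia.
have xn := ltn_ord x.
rewrite cardsCs finset.setCK card_ord cardsD card_ord_ltn ?(ltnW xn) //.
rewrite (finset.setIidPr _) ?card_low; first by lia.
by apply/fintype.subsetP => y; rewrite !inE; lia.
Qed.

(** With [l = x + 1 - k], truncated to 0 for small [x], this is the telescoping sum of [l (l - 1)]
    up to [l = n - k]. *)
Lemma sum_low_pairs n k : k <= n ->
  3 * (\sum_(x < n) (x.+1 - k) * (x.+1 - k - 1)) = (n - k).+1 * (n - k) * (n - k - 1).
Proof.
elim: n => [|n IH]; first by rewrite big_ord0 sub0n muln0.
rewrite leq_eqVlt => /predU1P[->|kn].
  rewrite big1 ?subnn ?muln0 // => x _.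
  by rewrite (_ : x.+1 - n.+1 = 0) //; apply/eqP/ltn_ord.
rewrite big_ord_recr /= mulnDr IH //.
have -> : n.+1 - k = (n - k).+1 by lia.
by case: (n - k) => [|d]; rewrite ?subn1 //=; ring.
Qed.

Lemma sum_peaks n k : 0 < k < n ->
  3 * (\sum_(s : 'S_n) #|[set i | peak k s i]|) = (n - k - 1) * n`!.
Proof.
case/andP=> k0 kn.
have -> : \sum_(s : 'S_n) #|[set i | peak k s i]| =
    \sum_(x < n) \sum_(p : 'S_n) flanked (relevant k x) (low k x) p x.
  (* Pass to the inverse permutation and index by values instead of positions. *)
  rewrite exchange_big [RHS](reindex_inj invg_inj) /=; apply: eq_bigr => s _.
  rewrite -sum1dep_card big_mkcond [RHS](reindex_inj (@perm_inj _ s)) /=.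
  by apply: eq_bigr => i _; rewrite peak_flanked //; case: flanked.
have H x : (n - k).+1 * (n - k) * (\sum_(p : 'S_n) flanked (relevant k x) (low k x) p x) =
    (x.+1 - k) * (x.+1 - k - 1) * n`!.
  have [kx|xk] := leqP k x.
    have cR : #|relevant k x| = (n - k).+1 by apply: card_relevant; rewrite k0.
    have := @sum_perm_flanked n (relevant k x) (low k x) x; rewrite cR card_low subn1 /=; apply.
    - by rewrite !inE leqnn orbT.
    - apply/fintype.subsetP => y; rewrite !inE => yx; rewrite yx andbT -val_eqE /=; lia.
    - by lia.
  (* For [x < k] there is no low value, so both sides are 0. *)
  rewrite big1 => [|p _]; first by rewrite (_ : x.+1 - k = 0) ?muln0 ?mul0n //; lia.
  rewrite /flanked; case: existsP => // -[a]; rewrite inE; lia.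
(* The factor in [H] does not depend on [x], so it cancels after summation. *)
have d0 : 0 < (n - k).+1 * (n - k) by rewrite muln_gt0 subn_gt0 kn.
apply/eqP; rewrite -(eqn_pmul2l d0) mulnCA big_distrr /=.
under eq_bigr do rewrite H.
by rewrite -big_distrl /= mulnA sum_low_pairs ?(ltnW kn) // !mulnA.
Qed.

(** * The asymptotic estimate *)

Local Open Scope classical_set_scope.
Local Open Scope ring_scope.

Theorem theorem2 (R : realType) :
  exists C : R, \forall n \near \oo, (2 <= n)%N ->
    forall k : nat, (1 <= k <= n - 1)%N ->
      `| mean_longest_alt R n k - 2 * (n%:R - k%:R) / 3 |
        <= C * n%:R `^ (2 / 3).
Proof.
(* The error lies between -2/3 and 4/3, so 3 is a roomy bound, and the power of [n] is at least
   1. *)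
exists 3; near=> n => n2 k kn.
have k0 : (0 < k)%N by case/andP: kn.
have {}kn : (0 < k < n)%N by lia.
have n_ge1 : 1 <= n%:R `^ (2 / 3) :> R.
  by rewrite -[leLHS](powRr0 n%:R) ler_powR ?ler1n ?divr_ge0 //; apply: leq_trans n2.
apply: (@le_trans _ _ 3); last by rewrite ler_peMr.
rewrite /mean_longest_alt /expect_unif card_Sn.
set N : R := n`!%:R.
have N0 : 0 < N by rewrite ltr0n fact_gt0.
pose P := (\sum_(s : 'S_n) #|[set i | peak k s i]%SET|)%N.
have PE : 3 * P%:R = (n%:R - k%:R - 1) * N :> R.
  rewrite -natrM sum_peaks // natrM !natrB //; lia.
have lo : 2 * P%:R <= \sum_(s : 'S_n) (longest_alt k s)%:R :> R.
  rewrite -natr_sum -natrM ler_nat /P big_distrr /=; apply: leq_sum => s _.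
  by rewrite mul2n; case/andP: (longest_alt_peaks s k0).
have hi : \sum_(s : 'S_n) (longest_alt k s)%:R <= 2 * P%:R + 2 * N :> R.
  rewrite -natr_sum -!natrM -natrD ler_nat /P -card_Sn -sum1_card !big_distrr -big_split /=.
  by apply: leq_sum => s _; rewrite mul2n muln1 addn2; case/andP: (longest_alt_peaks s k0).
move: (\sum_(s : 'S_n) _) lo hi => S lo hi.
(* The mean number of peaks is [(n - k - 1) / 3], so centring at twice that mean leaves the offset
   2/3. *)
have -> : S / N - 2 * (n%:R - k%:R) / 3 = (S - 2 * P%:R) / N - 2 / 3.
  have -> : n%:R - k%:R = 3 * P%:R / N + 1 :> R by rewrite PE mulfK ?gt_eqF // subrK.
  by field; rewrite gt_eqF.
have : 0 <= (S - 2 * P%:R) / N <= 2.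
  by rewrite ler_pdivlMr // ler_pdivrMr //; lra.
by move: (_ / N) => u /andP[u0 u2]; rewrite ler_norml; apply/andP; split; lra.
Unshelve. all: by end_near.
Qed.
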